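(* For every pair of positive integers $k$ and $j$, there exist $j$ pairwise non-isomorphic finite trees $T_1,\ldots,T_j$ with $U_k(T_1)=U_k(T_2)=\cdots=U_k(T_j)$.
   Context: Let $x_1,x_2,\ldots$ be commuting indeterminates. For a partition $\lambda=(\lambda_1,\ldots,\lambda_l)$ put $\mathbf{x}_\lambda=x_{\lambda_1}\cdots x_{\lambda_l}$. For a finite tree $T=(V,E)$ and $A\subseteq E$, let $\lambda(A)$ be the partition of $|V|$ whose parts are the numbers of vertices of the connected components of the spanning subgraph $(V,A)$. For a positive integer $k$, the $U_k$-polynomial is $U_k(T)=\sum_{A\subseteq E,\ |A|\le k}\mathbf{x}_{\lambda(E\setminus A)}$. *)

(* Defs.v *)
From mathcomp Require Import all_boot all_order all_algebra.
From mathcomp.multinomials Require Import monalg.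

Set Implicit Arguments.
Unset Strict Implicit.
Unset Printing Implicit Defensive.

Import GRing.Theory.

Record sgraph := SGraph {
  vertex :> finType;
  edges : {set {set vertex}};
  card_edge : forall e, e \in edges -> #|e| = 2
}.

(* When A is a set of two-element sets, [set x; y] \in A forces x != y,
   so adj A is irreflexive. *)
Definition adj (V : finType) (A : {set {set V}}) : rel V :=
  [rel x y | [set x; y] \in A].

Definition components (V : finType) (A : {set {set V}}) : {set {set V}} :=
  equivalence_partition (connect (adj A)) [set: V].

(* One component exactly: the graph with no vertex is excluded. *)
Definition graph_connected (G : sgraph) : Prop :=
  #|components (edges G)| = 1.

(* The bound on the size is needed: [:: x; y] is a ucycle for any edge xy. *)
Definition acyclic (G : sgraph) : Prop :=
  forall c : seq G, 2 < size c -> ~ ucycle (adj (edges G)) c.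

Definition is_tree (G : sgraph) : Prop := graph_connected G /\ acyclic G.

Definition isomorphic (G H : sgraph) : Prop :=
  exists f : G -> H, bijective f /\
    forall x y : G, adj (edges H) (f x) (f y) = adj (edges G) x y.

Definition component_type (V : finType) (A : {set {set V}}) : seq nat :=
  sort geq [seq #|C| | C : {set V} in components A].

(* The ring of integer polynomials in the indeterminates x_0, x_1, x_2, ...;
   x_0 never occurs below, because components are nonempty. *)
Notation polyring := {malg int[{cmonom nat}]}.

Definition indet (i : nat) : polyring := (<< ucm i >>)%R.

Definition xpart (l : seq nat) : polyring := (\prod_(i <- l) indet i)%R.

Definition Upoly (k : nat) (G : sgraph) : polyring :=
  (\sum_(A : {set {set G}} | (A \subset edges G) && (#|A| <= k)%N)
     xpart (component_type (edges G :\: A)))%R.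

(* Main.v *)
Require Import Defs.
From mathcomp Require Import all_boot all_order all_algebra.
From mathcomp Require Import zify.
From mathcomp.multinomials Require Import monalg.

(** The trees are found by counting: a family of trees is exhibited that has
    more members, up to isomorphism, than [j.-1] times the number of values
    that [Upoly k] can take on it.

    Let a tree have a root such that removing the root leaves only pieces with
    at most [w] vertices.  Deleting at most [k] edges produces one component
    that contains the root and at most [k] others, each of size at most [w]
    ([card_side_components], [side_component_size]).  The sizes of these side
    components determine the monomial, since the root component takes the
    remaining vertices.  Hence [Upoly k] is determined by a table with at most
    [w.+1 ^ k] entries, which counts the edge sets that yield each list of side
    sizes ([Upoly_profile]); with [n] vertices every entry is at most [n ^ k]
    ([profile_bound]).

    Now let each branch at the root spell a word of about [m] bits, so that
    [w] is linear in [m], and let the words that occur in the tree be an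
    arbitrary set [F] of words.  There are [2 ^ (2 ^ m).-1] choices for [F],
    whereas [n] is at most [2 ^ O(m)], so that the number of tables is
    [2 ^ P(m)] with [P] a polynomial ([word_trees_outnumber_profiles]).  The
    set [F] can be read off the isomorphism class ([word_tree_iso_sub]): the
    root is the only vertex with more than three neighbours, so an isomorphism
    respects parents, and the words are visible along the branches. *)

Set Implicit Arguments.
Unset Strict Implicit.
Unset Printing Implicit Defensive.

Import GRing.Theory.

(** * Counting *)

Lemma pigeonhole_fibre (T Q : finType) (D : {set T}) (f : T -> Q) (j : nat) :
  0 < j -> j.-1 * #|Q| < #|D| -> exists q, j <= #|[set x in D | f x == q]|.
Proof.
move=> j0 lt; apply/existsP; apply: contraLR lt; rewrite negb_exists -leqNgt.
move=> /forallP small.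
rewrite -sum1_card (partition_big f predT) //= mulnC -sum_nat_const.
apply: leq_sum => q _; have := small q; rewrite -ltnNge -sum1_card.
by under eq_bigl do rewrite inE; lia.
Qed.

(** Such a subset is the image of a map from [k] slots to its elements, with
    [None] filling the slots left over. *)
Lemma card_small_subsets (T : finType) (E : {set T}) (k : nat) :
  #|[set A : {set T} | (A \subset E) && (#|A| <= k)]| <= #|E|.+1 ^ k.
Proof.
pose D : {set option T} := None |: [set Some x | x in E].
have cardD : #|D| = #|E|.+1.
  rewrite cardsU1 card_imset; last by move=> x y [].
  by case: imsetP => [[]|].
rewrite -cardD -[k in _ ^ k]card_ord -card_ffun_on.
pose g (t : {ffun 'I_k -> option T}) := [set x | Some x \in codom t].
apply: leq_trans (leq_image_card g _); apply: subset_leq_card.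
apply/subsetP => A; rewrite inE => /andP [AE Ak].
apply/imageP; exists [ffun i : 'I_k => nth None (map Some (enum A)) i].
  apply/ffun_onP => i; rewrite ffunE.
  have [lti|lei] := ltnP i (size (map Some (enum A))).
    have /mapP [x xA ->] := mem_nth None lti.
    rewrite !inE /=; apply/imsetP; exists x => //.
    by apply: (subsetP AE); rewrite -mem_enum.
  by rewrite nth_default // !inE.
apply/setP => x; rewrite inE; apply/idP/codomP => [xA|[i]].
  have lti : index x (enum A) < #|A| by rewrite cardE index_mem mem_enum.
  exists (Ordinal (leq_trans lti Ak)); rewrite ffunE /= (nth_map x) -?cardE //.
  by rewrite nth_index // mem_enum.
rewrite ffunE => e.
have : Some x \in map Some (enum A).
  rewrite e mem_nth // ltnNge; apply/negP => /(nth_default None) e'.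
  by rewrite e' in e.
by case/mapP => y; rewrite mem_enum => yA [->].
Qed.

(** One constant [K] is the degree, the shift and the lower bound for [m] at once,
    so that a single inequality beats every polynomial in [m]. *)
Lemma exp2_dominates (K : nat) : exists2 m, K <= m & (2 * m + K) ^ K < 2 ^ m.
Proof.
(* For m = 2 ^ s the polynomial is at most 2 ^ (K * (s + K + 2)), and
   s = 2 * (K + 2) makes this exponent smaller than 2 ^ s. *)
pose s := 2 * (K + 2); exists (2 ^ s).
  by apply: leq_trans (ltnW (ltn_expl _ _)) => //; rewrite /s; lia.
have lt1 : K * (s + K + 2) < 2 ^ s.
  rewrite /s mul2n -addnn expnD.
  have a := ltn_expl (K + 2) (isT : 1 < 2).
  have b : K + 2 < 2 ^ (K + 2) by [].
  have c : 4 * K < 2 ^ (K + 2).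
    by rewrite addnC expnD ltn_pmul2l // ltn_expl.
  by nia.
apply: leq_ltn_trans (_ : 2 ^ (K * (s + K + 2)) < _); last by rewrite ltn_exp2l.
case: (posnP K) => [->//|K0]; rewrite [K * _]mulnC expnM leq_exp2r //.
have d := ltn_expl (K + 2) (isT : 1 < 2).
rewrite -addnA expnD.
have e : 0 < 2 ^ s by rewrite expn_gt0.
by nia.
Qed.

(** * Trees given by a parent function *)

(** The height is any function that drops along [parent]; it serves for
    induction towards the root and need not be the distance to it. *)
Record rooting (V : finType) := Rooting {
  root : V;
  parent : V -> V;
  height : V -> nat;
  parent_root : parent root = root;
  height_parent : forall v, v != root -> height (parent v) < height v
}.

Section RootedTree.

Variables (V : finType) (R : rooting V).
Local Notation r := (root R).
Local Notation p := (parent R).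
Local Notation h := (height R).

Definition parent_edge (v : V) : {set V} := [set v; p v].

Definition tree_edges : {set {set V}} := [set parent_edge v | v in [set~ r]].

Lemma parent_neq v : v != r -> p v != v.
Proof. by move=> /(height_parent) lt; apply: contraTneq lt => ->; rewrite ltnn. Qed.

Lemma card_tree_edge e : e \in tree_edges -> #|e| = 2.
Proof.
by case/imsetP => v; rewrite !inE => vr ->; rewrite cards2 eq_sym parent_neq.
Qed.

Definition tree_of : sgraph := SGraph card_tree_edge.

Lemma eq_set2 (x y a b : V) :
  [set x; y] = [set a; b] -> (x = a /\ y = b) \/ (x = b /\ y = a).
Proof.
move=> e; have ax : a \in [set x; y] by rewrite e set21.
have bx : b \in [set x; y] by rewrite e set22.
have := set21 x y; have := set22 x y; rewrite e; move: ax bx; rewrite !inE.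
by do 4![case/orP => /eqP ?]; subst; auto.
Qed.

Lemma parent_edge_inj : {in [set~ r] &, injective parent_edge}.
Proof.
move=> v u; rewrite !inE => vr ur /eq_set2 [[]//|[e1 e2]].
have := height_parent vr; have := height_parent ur.
by rewrite -e1 e2 => /ltn_trans lt /lt; rewrite ltnn.
Qed.

Lemma adj_sym (A : {set {set V}}) : symmetric (adj A).
Proof. by move=> x y; rewrite /adj /= setUC. Qed.

Lemma connect_adj_sym (A : {set {set V}}) : connect_sym (adj A).
Proof. exact/sym_connect_sym/adj_sym. Qed.

Lemma adj_treeP x y :
  reflect ((x != r /\ p x = y) \/ (y != r /\ p y = x)) (adj tree_edges x y).
Proof.
apply: (iffP imsetP) => [[v]|].
  by rewrite !inE => vr /eq_set2 [] [-> ->]; [left|right].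
by case=> -[n <-]; [exists x|exists y]; rewrite ?inE //= setUC.
Qed.

Lemma tree_connected : graph_connected tree_of.
Proof.
have toroot x : connect (adj tree_edges) x r.
  have [n] := ubnP (h x); elim: n x => // n IH x le.
  have [->//|xr] := eqVneq x r.
  apply: connect_trans (IH (p x) _); last by have := height_parent xr; lia.
  by apply/connect1/adj_treeP; left.
rewrite /graph_connected; apply/eqP/cards1P; exists setT; apply/setP => C.
rewrite inE; apply/imsetP/eqP => [[x _ ->]|->].
  apply/setP => y; rewrite !inE; apply: connect_trans (toroot x) _.
  by rewrite connect_adj_sym.
exists r => //; apply/setP => y; rewrite !inE; apply/esym.
by rewrite /= connect_adj_sym; apply: toroot.
Qed.

(** A vertex of maximal height on a cycle has both its neighbours on the cycle
    below it, and its parent is the only neighbour there. *)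
Lemma tree_acyclic : acyclic tree_of.
Proof.
move=> c sc /andP [cyc un].
case: c => // x0 c' in sc cyc un *; set c := x0 :: c' in sc cyc un.
have [x xc max] : exists2 x, x \in c & forall y, y \in c -> h y <= h x.
  have x0c : x0 \in c by rewrite inE eqxx.
  by case: (@arg_maxnP _ x0 (mem c) h x0c) => x xc m; exists x.
have near y : y \in c -> adj tree_edges x y -> y = p x.
  move=> yc /adj_treeP [[_ ->]//|[yr e]]; have := height_parent yr.
  by rewrite e ltnNge max.
have [i d ed] := rot_to xc.
have sd : size (x :: d) = size c by rewrite -ed size_rot.
rewrite -(rot_cycle i) in cyc; rewrite -(rot_uniq i) in un.
have memd y : y \in x :: d -> y \in c by rewrite -ed mem_rot.
rewrite ed in cyc un.
case: d {ed} sd cyc un memd => [|y d]; first by move=> e; rewrite -e in sc.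
case/lastP: d => [|d z]; first by move=> e; rewrite -e in sc.
move=> _ /= /andP [xy]; rewrite rcons_path last_rcons => /andP [_ zx] un memd.
rewrite adj_sym in zx.
have yc : y \in c by apply: memd; rewrite !inE eqxx orbT.
have zc : z \in c by apply: memd; rewrite !(inE, mem_rcons) eqxx !orbT.
have yz : y = z by rewrite (near y yc xy) (near z zc zx).
by move: un => /and3P [_]; rewrite yz mem_rcons inE eqxx.
Qed.

Lemma tree_of_is_tree : is_tree tree_of.
Proof. exact: conj tree_connected tree_acyclic. Qed.

Definition side_components (A : {set {set V}}) : {set {set V}} :=
  [set C in components (tree_edges :\: A) | r \notin C].

Lemma side_componentP (A : {set {set V}}) D :
  D \in side_components A ->
  exists2 x, D = [set y | connect (adj (tree_edges :\: A)) x y] & r \notin D.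
Proof.
rewrite inE => /andP [/imsetP [x _ ->] rC]; exists x => //.
by apply/setP => y; rewrite !inE.
Qed.

(** The lowest vertex of a side component is cut off from its parent, so it
    names an edge of [A], and different components name different edges. *)
Lemma card_side_components (A : {set {set V}}) :
  #|side_components A| <= #|A|.
Proof.
pose e := adj (tree_edges :\: A).
pose B := [set v in [set~ r] | parent_edge v \in A].
have leB : #|B| <= #|A|.
  rewrite -(card_in_imset (f := parent_edge) (D := B)); last first.
    by move=> u v /setIdP [ur _] /setIdP [vr _]; apply: parent_edge_inj.
  by apply/subset_leq_card/subsetP => _ /imsetP [v /setIdP [_ vA] ->].
apply: leq_trans leB.
apply: leq_trans (leq_imset_card (fun v => [set y | connect e v y]) _).
apply/subset_leq_card/subsetP => D /side_componentP [x eD rD].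
have xD : x \in D by rewrite eD inE connect0.
case: (@arg_minnP _ x (mem D) h xD) => v; rewrite -topredE /= => vD min.
have vr : v != r by apply: contraNneq rD => <-.
have xv : connect e x v by rewrite eD inE in vD.
apply/imsetP; exists v; last first.
  rewrite eD; apply/setP => y; rewrite !inE.
  exact: (same_connect (connect_adj_sym _)).
rewrite !inE vr /=; apply: contraT => vA.
have : p v \in D.
  rewrite eD inE; apply: connect_trans xv (connect1 _).
  by rewrite /e /adj /= inE vA /=; apply: imset_f; rewrite !inE.
by move/min; rewrite leqNgt height_parent.
Qed.

(** The function [b] names the branch of a vertex at the root; a side component
    cannot leave its branch, because the only way out is through the root. *)
Lemma side_component_size (I : eqType) (b : V -> I) (w : nat) (A : {set {set V}}) D :
  (forall v, p v != r -> b (p v) = b v) ->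
  (forall i, #|[set v in [set~ r] | b v == i]| <= w) ->
  D \in side_components A -> #|D| <= w.
Proof.
move=> bp bw /side_componentP [x eD rD].
apply: leq_trans (bw (b x)); apply/subset_leq_card/subsetP => y yD.
have yr : y != r by apply: contraNneq rD => <-.
rewrite !inE yr /=.
move: yD rD; rewrite eD !inE => /connectP [s]; elim: s x {eD yr} => [|z s IH] x /=.
  by move=> _ ->.
move=> /andP [xz ps] ey rx.
have cxz := connect1 xz.
have rz : ~~ connect (adj (tree_edges :\: A)) z r.
  by apply: contraNN rx; apply: connect_trans.
have zr : z != r by apply: contraNneq rz => ->.
have xr : x != r by apply: contraNneq rx => ->.
rewrite (eqP (IH z ps ey rz)).
have : adj tree_edges x z by move: xz; rewrite /adj /= inE => /andP [].
case/adj_treeP => -[_ e].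
  by rewrite -e bp ?e.
by rewrite -e bp ?e.
Qed.

End RootedTree.

(** An edge could only be reversed by [f] if the same happened to the edge
    below it, and so on down to the root, which [f] fixes. *)
Lemma iso_parent (V W : finType) (R : rooting V) (S : rooting W) (f : V -> W) :
    injective f -> f (root R) = root S ->
    (forall x y, adj (tree_edges S) (f x) (f y) = adj (tree_edges R) x y) ->
  forall v, f (parent R v) = parent S (f v).
Proof.
move=> inj fr fadj v; have [n] := ubnP (height R v); elim: n v => // n IH v le.
have [->|vr] := eqVneq v (root R); first by rewrite parent_root fr parent_root.
have : adj (tree_edges S) (f v) (f (parent R v)).
  by rewrite fadj; apply/adj_treeP; left.
case/adj_treeP => [[_ ->]//|[pr e]].
have lt := height_parent vr.
have e' : parent R (parent R v) = v by apply: inj; rewrite IH; last lia.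
have := @height_parent _ R (parent R v); rewrite -(inj_eq inj) fr => /(_ pr).
by rewrite e'; lia.
Qed.

(** * U_k in terms of the components away from the root *)

(** A list of at most [k] parts of size at most [w] is stored in a fixed finite
    type: the unused slots hold 0, which is not the size of a component. *)
Definition part_code (k w : nat) (s : seq nat) : {ffun 'I_k -> 'I_w.+1} :=
  [ffun i : 'I_k => inord (nth 0 s i)].

Lemma big_part_code (T : Type) (idx : T) (op : Monoid.law idx) (F : nat -> T)
    (k w : nat) (s : seq nat) :
    size s <= k -> (forall x, x \in s -> 0 < x <= w) ->
  \big[op/idx]_(i | part_code k w s i != 0 :> nat) F (part_code k w s i)
    = \big[op/idx]_(x <- s) F x.
Proof.
move=> sk sw.
have val (i : 'I_k) : part_code k w s i = nth 0 s i :> nat.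
  rewrite ffunE inordK // ltnS; have [lt|le] := ltnP i (size s).
    by have /andP [] := sw _ (mem_nth 0 lt).
  by rewrite nth_default.
under eq_bigl do rewrite val; under eq_bigr do rewrite val.
rewrite -(big_mkord (fun i => nth 0 s i != 0) (fun i => F (nth 0 s i))).
rewrite (big_cat_nat _ sk) //= [X in op _ X]big_nat_cond [X in op _ X]big_pred0.
  rewrite Monoid.mulm1 [RHS](big_nth 0) big_nat_cond [RHS]big_nat_cond.
  apply: eq_bigl => i; rewrite leq0n andbT andTb; case: (ltnP i) => //= lt.
  by have /andP [] := sw _ (mem_nth 0 lt); rewrite lt0n => ->.
by move=> i; case: (leqP (size s)) => //= le; rewrite nth_default // eqxx andbF.
Qed.

(** The root component has the vertices that the side components leave. *)
Definition code_monomial (k w n : nat) (q : {ffun 'I_k -> 'I_w.+1}) : polyring :=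
  (indet (n - \sum_(i | q i != 0 :> nat) q i)%N *
   \prod_(i | q i != 0 :> nat) indet (q i))%R.

Section Profile.

Variables (V : finType) (R : rooting V) (k w : nat).
Local Notation edges := (tree_edges R).

Definition side_code (A : {set {set V}}) : {ffun 'I_k -> 'I_w.+1} :=
  part_code k w [seq #|D| | D : {set V} in side_components R A].

Definition profile (q : {ffun 'I_k -> 'I_w.+1}) : nat :=
  #|[set A : {set {set V}} | [&& A \subset edges, #|A| <= k & side_code A == q]]|.

Lemma profile_bound q : profile q <= #|V| ^ k.
Proof.
have lt : #|edges| < #|V|.
  rewrite -cardsT (cardsD1 (root R)) inE add1n ltnS setTD.
  exact: leq_imset_card.
apply: (@leq_trans (#|edges|.+1 ^ k));
  last by case: (posnP k) => [->//|k0]; rewrite leq_exp2r.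
apply: leq_trans (card_small_subsets edges k); apply/subset_leq_card/subsetP => A.
by rewrite !inE => /and3P [-> ->].
Qed.

Definition profile_table :
    {ffun {ffun 'I_k -> 'I_w.+1} -> 'I_(#|V| ^ k).+1} :=
  [ffun q => inord (profile q)].

Lemma profile_tableE q : profile_table q = profile q :> nat.
Proof. by rewrite ffunE inordK // ltnS profile_bound. Qed.

Hypothesis side_size :
  forall A D, D \in side_components R A -> #|D| <= w.

Lemma xpart_side_code (A : {set {set V}}) : #|A| <= k ->
  xpart (component_type (edges :\: A)) = code_monomial #|V| (side_code A).
Proof.
move=> Ak; set P := components (edges :\: A).
have eqvR : equivalence_rel (connect (adj (edges :\: A))).
  by apply/equivalence_relP; split=> [x|x y /(same_connect (@connect_adj_sym _ _))].
have part : partition P [set: V].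
  by apply: equivalence_partitionP => x y z _ _ _; apply: eqvR.
pose C := pblock P (root R).
have rcover : root R \in cover P by rewrite (cover_partition part).
have CP : C \in P by apply: pblock_mem.
have sideE D : (D \in side_components R A) = (D \in P) && (D != C).
  rewrite inE -/P; case DP: (D \in P) => //=; congr (~~ _).
  apply/idP/eqP => [rD|->]; last by rewrite mem_pblock.
  by apply/esym/(def_pblock (partition_trivIset part)).
(* Needed for the sum of the sizes as well as the product of indeterminates. *)
have splitP (T : Type) (idx : T) (op : Monoid.com_law idx) (F : nat -> T) :
    \big[op/idx]_(D in P) F #|D| =
    op (F #|C|) (\big[op/idx]_(i | side_code A i != 0 :> nat) F (side_code A i)).
  rewrite (bigD1 C) //=; congr (op _ _).
  rewrite big_part_code.
  - by rewrite big_map big_enum /=; apply: eq_bigl => D; rewrite sideE.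
  - rewrite size_map -cardE; exact: leq_trans (card_side_components _ _) Ak.
  - move=> x /mapP [D]; rewrite mem_enum => Dside ->; rewrite (side_size Dside).
    rewrite sideE in Dside; case/andP: Dside => DP _.
    rewrite andbT card_gt0; apply: contraTneq DP => ->.
    by case/and3P: part.
have sumV : #|V| = #|C| + \sum_(i | side_code A i != 0 :> nat) side_code A i.
  rewrite -cardsT (card_partition part).
  exact: (splitP _ _ _ id).
rewrite /code_monomial sumV addnK /xpart /component_type.
rewrite (perm_big _ (permEl (perm_sort _ _))) big_map big_enum /=.
exact: (splitP _ _ _ indet).
Qed.

(** Of the tree, only [#|V|] and [profile] appear on the right: trees with equal
    profiles on equally many vertices have the same [Upoly k]. *)
Lemma Upoly_profile :
  Upoly k (tree_of R) = (\sum_q code_monomial #|V| q *+ profile q)%R.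
Proof.
rewrite /Upoly (partition_big side_code predT) //=; apply: eq_bigr => q _.
rewrite /profile -sumr_const.
apply: congr_big => // A; first by rewrite inE andbA.
by move=> /andP [/andP [_ Ak] /eqP <-]; rewrite xpart_side_code.
Qed.

End Profile.

Lemma eq_profile_Upoly (V : finType) (R S : rooting V) (k w : nat) :
    (forall A D, D \in side_components R A -> #|D| <= w) ->
    (forall A D, D \in side_components S A -> #|D| <= w) ->
    profile_table R k w = profile_table S k w ->
  Upoly k (tree_of R) = Upoly k (tree_of S).
Proof.
move=> Rw Sw eqRS; rewrite (Upoly_profile k Rw) (Upoly_profile k Sw).
by apply: eq_bigr => q _; rewrite -!profile_tableE eqRS.
Qed.

(** * Trees spelling sets of words *)

Section WordTrees.

Variable m : nat.
(** Every word W : {set 'I_m.+1} has a branch: a path of spine vertices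
    starting next to the root, and one bud for each spine vertex.  A bud hangs
    on its spine vertex when the letter is shown, and on the root otherwise;
    in this way all trees of the family have the same vertices. *)
Local Notation word := {set 'I_m.+1}.
Local Notation node := (option (word * bool * 'I_m.+1)).

Definition spine (W : word) (i : 'I_m.+1) : node := Some (W, false, i).
Definition bud (W : word) (i : 'I_m.+1) : node := Some (W, true, i).

Definition shown (F : {set word}) (W : word) : word := if W \in F then W else set0.

Definition word_parent (F : {set word}) (v : node) : node :=
  match v with
  | None => None
  | Some (W, false, i) => if i == 0 :> nat then None else spine W (inord i.-1)
  | Some (W, true, i) => if i \in shown F W then spine W i else None
  end.

Definition word_height (v : node) : nat :=
  if v is Some (_, b, i) then b + i.+1 else 0.

Lemma word_height_parent F v :
  v != None -> word_height (word_parent F v) < word_height v.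
Proof.
case: v => [[[W []] i]|] //= _; first by case: ifP.
have lti := ltn_ord i; case: eqP => /= i0; rewrite ?inordK ?add0n; lia.
Qed.

Definition word_tree (F : {set word}) : rooting node :=
  @Rooting _ None (word_parent F) word_height erefl (@word_height_parent F).

Lemma card_word_tree : #|{: node}| = (2 ^ m.+1 * 2 * m.+1).+1.
Proof.
by rewrite card_option !card_prod card_bool card_ord -cardsT -powersetT
     card_powerset cardsT card_ord.
Qed.

Lemma word_tree_side_size F A D :
  D \in side_components (word_tree F) A -> #|D| <= 2 * m.+1.
Proof.
pose b (v : node) := if v is Some (W, _, _) then Some W else None.
apply: (side_component_size (b := b)) => [[[[W []] i]|] //=|[W|]].
- by case: ifP.
- by case: ifP.
- have -> : 2 * m.+1 = #|{: bool * 'I_m.+1}| by rewrite card_prod card_bool card_ord.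
  apply: leq_trans (leq_imset_card (fun x => Some (W, x.1, x.2)) _).
  apply/subset_leq_card/subsetP => -[[[W' c] i]|]; rewrite !inE //= => /eqP [->].
  by apply/imsetP; exists (c, i).
- by rewrite eq_card0 // => -[[[W' c] i]|]; rewrite !inE.
Qed.

Lemma iter_None F n : iter n (word_parent F) None = None.
Proof. by elim: n => //= n ->. Qed.

Lemma iter_spine F W i n :
  iter n (word_parent F) (spine W i) =
  if n <= i then spine W (inord (i - n)) else None.
Proof.
elim: n => [|n IH]; first by rewrite subn0 inord_val.
rewrite iterS IH; case: (leqP n i) => [le|lt]; last by rewrite [n < i]ltnNge ltnW //.
have lti := ltn_ord i.
rewrite /= inordK; last by lia.
by rewrite subn_eq0; case: ltnP; rewrite ?subnS.
Qed.

(** The depth singles out the branches: with no bud at the last place, a vertex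
    at distance more than [m] from the root is the last spine vertex of a branch or the
    bud next to it, and has the spine of that branch below it. *)
Lemma deep_spine (F : {set word}) y : ord_max \notin \bigcup_(W in F) W -> 0 < m ->
    iter m (word_parent F) y != None ->
  exists W, forall i : 'I_m.+1, i < m -> iter (m - i) (word_parent F) y = spine W i.
Proof.
move=> nomax m0; case: y => [[[W []] i]|]; last by rewrite iter_None.
  rewrite -[X in iter X]prednK // iterSr /=; case: ifP; last by rewrite iter_None.
  move=> iW; rewrite iter_spine; case: leqP => // le _; exists W => l lm.
  have im : i < m.
    rewrite ltn_neqAle -ltnS ltn_ord andbT; apply: contraNneq nomax => e.
    have -> : ord_max = i by apply: val_inj.
    by apply/bigcupP; exists W; move: iW; rewrite /shown; case: ifP; rewrite ?inE.
  have -> : m - l = (m - l).-1.+1 by lia.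
  rewrite iterSr /= iW iter_spine ifT; last by lia.
  by congr spine; apply: val_inj; rewrite /= inordK; lia.
rewrite iter_spine; case: leqP => // le _; exists W => l lm.
have lti := ltn_ord i.
rewrite iter_spine ifT; last by lia.
by congr spine; apply: val_inj; rewrite /= inordK; lia.
Qed.

(** The bud at [i] is shown exactly when the spine vertex at [i], which has the next
    spine vertex as a child anyway, has a second child. *)
Lemma forkP F W (i : 'I_m.+1) : i < m ->
  reflect (exists y z, [/\ y != z, word_parent F y = spine W i &
                           word_parent F z = spine W i])
          (i \in shown F W).
Proof.
move=> im; apply: (iffP idP) => [iW|[y [z [yz ey ez]]]].
  exists (bud W i), (spine W (inord i.+1)).
  split; [by apply/eqP => -[]|by rewrite /= iW|].
  by rewrite /= inordK //= inord_val.
apply: contraNT yz => iW.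
suff child v : word_parent F v = spine W i -> v = spine W (inord i.+1).
  by rewrite (child y) // (child z).
case: v => [[[W' []] l]|] //=.
  by case: ifP => // lW [eW el]; rewrite eW el (negPf iW) in lW.
case: eqP => // l0 [-> <-]; congr spine; apply: val_inj.
have lm := ltn_ord l; rewrite /= !inordK ?prednK //; lia.
Qed.

Lemma word_tree_neighbours F v : v != None ->
  exists s : seq node, size s <= 3 /\
    forall u, adj (tree_edges (word_tree F)) v u -> u \in s.
Proof.
case: v => [[[W b] i]|] // _.
exists [:: word_parent F (Some (W, b, i)); spine W (inord i.+1); bud W i].
split=> // u /adj_treeP [[_ <-]|[_]]; first by rewrite inE eqxx.
case: u => [[[W' []] l]|] //=.
  by case: ifP => // _ [<- _ <-]; rewrite !inE eqxx !orbT.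
case: eqP => // l0 [<- _ <-].
have e : l = inord (inord l.-1 : 'I_m.+1).+1.
  by apply: val_inj; have lm := ltn_ord l; rewrite /= !inordK ?prednK //; lia.
by rewrite -e !inE eqxx !orbT.
Qed.

(** The first spine vertices of the [2 ^ m.+1] branches are adjacent to the root,
    which gives it more than three neighbours; no other vertex has as many. *)
Lemma iso_word_tree_root F F' (f : node -> node) : 1 < m -> injective f ->
    (forall x y, adj (tree_edges (word_tree F')) (f x) (f y)
                 = adj (tree_edges (word_tree F)) x y) ->
  f None = None.
Proof.
move=> m1 inj fadj; apply/eqP; apply: contraT => /(word_tree_neighbours F').
case=> s [s3 all_s].
pose t := [seq f (spine W ord0) | W <- enum {: word}].
suff : size t <= size s.
  rewrite size_map -cardE -cardsT -powersetT card_powerset cardsT card_ord.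
  have : 2 ^ 3 <= 2 ^ m.+1 by rewrite leq_exp2l.
  lia.
apply: uniq_leq_size; first by rewrite map_inj_uniq ?enum_uniq // => W W' /inj [].
move=> _ /mapP [W _ ->]; apply: all_s; rewrite fadj.
by apply/adj_treeP; right.
Qed.

(** The empty word cannot be told from a word outside [F], and a bud at
    [ord_max] would be the only child of its spine vertex and make no fork. *)
Definition admissible : {set word} := powerset [set~ ord_max] :\ set0.

Lemma card_admissible : #|admissible| = (2 ^ m).-1.
Proof.
have := cardsD1 set0 (powerset [set~ (ord_max : 'I_m.+1)]).
rewrite card_powerset cardsC1 card_ord inE sub0set add1n /= => ->.
by [].
Qed.

(** The far end of the branch of W in F is sent to the far end of some branch W'
    (or the bud next to it).  Since an isomorphism commutes with parents, the
    whole spine below goes along and keeps its forks, so W' shows the letters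
    of W; as W is not empty, W' must belong to F' and be W. *)
Lemma word_tree_iso_sub (F F' : {set word}) :
    1 < m -> F \subset admissible -> F' \subset admissible ->
  isomorphic (tree_of (word_tree F)) (tree_of (word_tree F')) -> F \subset F'.
Proof.
move=> m1 Fc Fc' [f [bij fadj]]; have inj := bij_inj bij.
have admP W : W \in admissible -> W != set0 /\ ord_max \notin W.
  rewrite !inE => /andP [-> /subsetP sub]; split=> //.
  by apply/negP => /sub; rewrite !inE eqxx.
have fr : f None = None by apply: (iso_word_tree_root (F := F) (F' := F') m1 inj fadj).
have fp v : f (word_parent F v) = word_parent F' (f v).
  exact: (@iso_parent _ _ (word_tree F) (word_tree F') f inj fr fadj).
have fiter n v : f (iter n (word_parent F) v) = iter n (word_parent F') (f v).
  by elim: n => //= n IH; rewrite fp IH.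
apply/subsetP => W WF; have [W0 maxW] := admP W (subsetP Fc W WF).
have [|||W' eW'] := @deep_spine F' (f (spine W ord_max)).
- by apply/bigcupP => -[T TF']; apply/negP; case: (admP T (subsetP Fc' T TF')).
- exact: ltnW.
- by rewrite -fiter -fr (inj_eq inj) iter_spine leqnn.
have fspine (i : 'I_m.+1) : i < m -> f (spine W i) = spine W' i.
  move=> im; rewrite -eW' // -fiter iter_spine leq_subr subKn ?inord_val //.
  exact: ltnW.
have eW (i : 'I_m.+1) : i < m -> (i \in W) = (i \in shown F' W').
  move=> im; have -> : W = shown F W by rewrite /shown WF.
  apply/(forkP F _ im)/(forkP F' _ im) => -[y [z [yz ey ez]]].
    by exists (f y), (f z); rewrite (inj_eq inj) -!fp ey ez fspine.
  case: bij => g fK gK; exists (g y), (g z).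
  rewrite (can_eq gK) yz; split=> //; apply: inj; rewrite fp gK fspine //.
(* A letter of W is shown in the branch of W', hence W' belongs to F'. *)
have [i iW] := set0Pn _ W0.
have lt_max T (l : 'I_m.+1) : T \in admissible -> l \in T -> l < m.
  case/admP => _ maxT lT; rewrite ltn_neqAle -ltnS ltn_ord andbT.
  by apply: contraNneq maxT => e; have -> : ord_max = l by apply: val_inj.
have WC := subsetP Fc W WF.
have := eW i (lt_max W i WC iW); rewrite iW /shown => /esym.
case: ifP => [W'F' _|_]; last by rewrite inE.
have WC' := subsetP Fc' W' W'F'.
suff -> : W = W' by [].
apply/setP => l; have [lm|ml] := ltnP l m; first by rewrite eW // /shown W'F'.
by apply/idP/idP => /lt_max => [/(_ WC)|/(_ WC')]; rewrite ltnNge ml.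
Qed.

End WordTrees.

Lemma isomorphic_sym (G H : sgraph) : isomorphic G H -> isomorphic H G.
Proof.
case=> f [[g fK gK] fadj]; exists g; split; first by exists f.
by move=> x y; rewrite -fadj !gK.
Qed.

(** The second factor counts the profiles: its base the values of one entry, its
    exponent the entries.  The right side counts the sets of admissible words. *)
Lemma word_trees_outnumber_profiles (k j : nat) : exists2 m, 1 < m &
  j.-1 * (((2 ^ m.+1 * 2 * m.+1).+1 ^ k).+1 ^ ((2 * m.+1).+1 ^ k)) < 2 ^ (2 ^ m).-1.
Proof.
have [m Km dom] := exp2_dominates (k + j + 4); exists m; first by lia.
set u := 2 * m + (k + j + 4) in dom.
have m1 := ltn_expl m (isT : 1 < 2).
have cardV : (2 ^ m.+1 * 2 * m.+1).+1 <= 2 ^ (2 * m + 3).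
  by rewrite !expnS mul2n -addnn !expnD; nia.
have cardQ : ((2 ^ m.+1 * 2 * m.+1).+1 ^ k).+1 <= 2 ^ ((2 * m + 3) * k + 1).
  have le : (2 ^ m.+1 * 2 * m.+1).+1 ^ k <= 2 ^ ((2 * m + 3) * k).
    by rewrite expnM; case: (posnP k) => [->//|k0]; rewrite leq_exp2r.
  have pos : 0 < 2 ^ ((2 * m + 3) * k) by rewrite expn_gt0.
  by rewrite [_ * k + 1]addn1 [leqRHS]expnS; lia.
have e3 : (2 * m.+1).+1 = 2 * m + 3 by lia.
rewrite e3.
apply: leq_ltn_trans (_ : 2 ^ j.-1 * 2 ^ (((2 * m + 3) * k + 1) * (2 * m + 3) ^ k) < _).
  apply: leq_mul; first exact/ltnW/ltn_expl.
  by rewrite expnM leq_exp2r // expn_gt0 addnS.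
rewrite -expnD ltn_exp2l //.
have u0 : 0 < u by lia.
have bound : ((2 * m + 3) * k + 1) * (2 * m + 3) ^ k <= u ^ (k + 2).
  rewrite addn2 !expnS mulnA; apply: leq_mul; first by rewrite /u; nia.
  by case: (posnP k) => [->//|k0]; rewrite leq_exp2r // /u; lia.
have lej : u ^ (k + 2) + j.+1 <= u ^ (k + 3).
  rewrite [k + 3]addnS expnS.
  have : 0 < u ^ (k + 2) by rewrite expn_gt0 u0.
  have : j.+1 < u by rewrite /u; lia.
  by nia.
have : u ^ (k + 3) <= u ^ (k + j + 4) by rewrite leq_pexp2l //; lia.
lia.
Qed.

Theorem corollary2p3 (k j : nat) (hk : 0 < k) (hj : 0 < j) :
  exists T : 'I_j -> sgraph,
    [/\ forall i : 'I_j, is_tree (T i),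
        forall i i' : 'I_j, i != i' -> ~ isomorphic (T i) (T i')
      & forall i i' : 'I_j, Upoly k (T i) = Upoly k (T i')].
Proof.
have [m m1 many] := word_trees_outnumber_profiles k j.
have [|q] := @pigeonhole_fibre _ _ (powerset (admissible m))
               (fun F => profile_table (word_tree F) k (2 * m.+1)) j hj.
  by rewrite card_powerset card_admissible !card_ffun !card_ord card_word_tree.
set D := [set F in _ | _] => jD.
pose F (i : 'I_j) := enum_val (widen_ord jD i).
have FD i : F i \in D by apply: enum_valP.
have Fc i : F i \subset admissible m by have := FD i; rewrite !inE => /andP [].
exists (fun i => tree_of (word_tree (F i))); split=> [i|i i' ne iso|i i'].
- exact: tree_of_is_tree.
- have /enum_val_inj /(congr1 val) /= /val_inj e : F i = F i'.
    apply/eqP; rewrite eqEsubset.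
    by rewrite !(word_tree_iso_sub m1 (Fc _) (Fc _)) //; apply: isomorphic_sym.
  by rewrite e eqxx in ne.
- apply: (eq_profile_Upoly (@word_tree_side_size m _) (@word_tree_side_size m _)).
  have := FD i; have := FD i'; rewrite !inE.
  by move=> /andP [_ /eqP ->] /andP [_ /eqP ->].
Qed.
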